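(* Let $(X,\triangleright)$ be a shelf, $I\subseteq\mathbb{Z}^+$, and for all $i,j\in I$ let $\alpha_{ij}:X\to X$ be bijective maps such that $\alpha_{ih}(a)\triangleright\alpha_{jh}(b)=\alpha_{jh}(\alpha_{ij}(a)\triangleright b)$ for all $a,b\in X$, $i,j,h\in I$. Consider the $p$-shelf $(X,\triangleright_{z_{ij}})$ given by $a\triangleright_{z_{ij}}b:=\alpha_{ij}(a)\triangleright b$ for all $a,b\in X$, $i,j\in I$. For all $i\in I$ let $t_i,\kappa_i:X\to X$ be bijective maps such that $\kappa_i=t_i\,\alpha_{\bar ii}$. Then the maps $K_i:X\to X$, $a\mapsto\kappa_i(a)$ $(i\in I)$, form a bijective reflection if and only if (i) $t_i\big((b\triangleright a)\triangleright b\big)=(b\triangleright a)\triangleright t_i(b)$, (ii) $\alpha_{\bar ij}\alpha_{\bar ii}^{-1}(a)\triangleright b=\alpha_{ij}t_i(a)\triangleright b$, for all $a,b\in X$ and $i,j\in I$.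
   Context: A (left) shelf is a non-empty set $X$ with a binary operation $\triangleright$ such that $a\triangleright(b\triangleright c)=(a\triangleright b)\triangleright(a\triangleright c)$ for all $a,b,c$. Parametric objects depend on parameters $z_i$ indexed by $i\in I$; a subscript or superscript $z_{ij}$ denotes dependence on the ordered pair $(i,j)$, and $f_i$ is shorthand for a map depending on $z_i$. There is a fixed involutive map $\mu$ on the parameters, $z_{\bar i}:=\mu(z_i)$; it is regarded as an involution $i\mapsto\bar i$ of $I$. $(X,\triangleright_{z_{ij}})$ is a $p$-shelf if $a\triangleright_{z_{ik}}(b\triangleright_{z_{jk}}c)=(a\triangleright_{z_{ij}}b)\triangleright_{z_{jk}}(a\triangleright_{z_{ik}}c)$ for all $a,b,c\in X$, $i,j,k\in I$ (this holds for the operations in the claim). The associated $p$-shelf solution is $R^{z_{ij}}(b,a)=(b,\,b\triangleright_{z_{ij}}a)$ on $X\times X$. Put $R_{12}^{z_{ij}}=R^{z_{ij}}$ and $R_{21}^{z_{ij}}=\pi R^{z_{ij}}\pi$ with $\pi(x,y)=(y,x)$. The family $K_i:X\to X$, $a\mapsto\kappa_i(a)$ $(i\in I)$ is a reflection if for all $i,j\in I$ the following identity of maps on $X\times X$ (composition) holds: $$R_{12}^{z_{ij}}\,(K_i\times\mathrm{id})\,R_{21}^{z_{j\bar i}}\,(\mathrm{id}\times K_j)=(\mathrm{id}\times K_j)\,R_{12}^{z_{i\bar j}}\,(K_i\times\mathrm{id})\,R_{21}^{z_{\bar j\bar i}}.$$ *)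

(* Defs.v *)
From mathcomp Require Import all_boot.
From mathcomp Require Import boolp classical_sets functions.
Set Implicit Arguments.
Unset Strict Implicit.
Unset Printing Implicit Defensive.

Declare Scope shelf_scope.
Delimit Scope shelf_scope with shelf.

Record shelf := Shelf {
  shelf_sort :> Type;
  shelf_op : shelf_sort -> shelf_sort -> shelf_sort;
  shelf_nonempty : inhabited shelf_sort;
  shelf_distr : forall a b c : shelf_sort,
    shelf_op a (shelf_op b c) = shelf_op (shelf_op a b) (shelf_op a c) }.

Arguments shelf_op {s} a b.

Notation "a ▷ b" := (shelf_op a b)
  (at level 40, left associativity) : shelf_scope.

Local Open Scope shelf_scope.

(* The parameters [z_i] enter only through their indices: [T] is the index set,
   and [pshelf_op p i j a b] is [a ▷_{z_ij} b]. *)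
Record pshelf (T X : Type) := PShelf {
  pshelf_op : T -> T -> X -> X -> X;
  pshelf_nonempty : inhabited X;
  pshelf_distr : forall (i j k : T) (a b c : X),
    pshelf_op i k a (pshelf_op j k b c) =
    pshelf_op j k (pshelf_op i j a b) (pshelf_op i k a c) }.

Section Reflection.
Variables (T X : Type).
Implicit Types (p : pshelf T X) (bar : T -> T) (K : T -> X -> X).

Definition prod_map (f g : X -> X) (x : X * X) : X * X := (f x.1, g x.2).

Definition pshelf_R12 p (i j : T) (x : X * X) : X * X :=
  (x.1, pshelf_op p i j x.1 x.2).

Definition pshelf_R21 p (i j : T) : X * X -> X * X :=
  swap_pair \o pshelf_R12 p i j \o swap_pair.

Definition reflection bar p K : Prop := forall i j : T,
  pshelf_R12 p i j \o prod_map (K i) id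
    \o pshelf_R21 p j (bar i) \o prod_map id (K j)
  =1
  prod_map id (K j) \o pshelf_R12 p i (bar j)
    \o prod_map (K i) id \o pshelf_R21 p (bar j) (bar i).

Definition bijective_reflection bar p K : Prop :=
  reflection bar p K /\ forall i : T, bijective (K i).

End Reflection.

Section Twist.
Variables (T : Type) (X : shelf) (alpha : T -> T -> X -> X).

Definition twist_compatible : Prop := forall (i j h : T) (a b : X),
  alpha i h a ▷ alpha j h b = alpha j h (alpha i j a ▷ b).

Definition twist_op (i j : T) (a b : X) : X := alpha i j a ▷ b.

Lemma twist_distr : twist_compatible -> forall (i j k : T) (a b c : X),
  twist_op i k a (twist_op j k b c) =
  twist_op j k (twist_op i j a b) (twist_op i k a c).
Proof. by move=> h i j k a b c; rewrite /twist_op shelf_distr h. Qed.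

Definition twist_pshelf (h : twist_compatible) : pshelf T X :=
  PShelf (shelf_nonempty X) (twist_distr h).

End Twist.

Section BijInv.
Variables (X Y : Type) (f : X -> Y) (fbij : bijective f).

Definition bij_inv : Y -> X := ((sval (PbijTT fbij))^-1)%FUN.

Lemma bij_invK : cancel f bij_inv.
Proof.
rewrite /bij_inv; case: (PbijTT fbij) => s /= fs x.
by rewrite [in LHS]fs funK // inE.
Qed.

Lemma bij_invVK : cancel bij_inv f.
Proof. by case: (fbij) => g fK gK y; rewrite -[y in LHS]gK bij_invK. Qed.

End BijInv.

(* Main.v *)
(* With [u] and [v] the first coordinates before [K i] is applied, injectivity
   of [K i] makes the first components of the reflection equation agree iff
   [u = v], which is (ii) for the indices [j] and [bar i].  Granting (ii), the
   compatibility of [alpha] turns the second components, evaluated at [(x, y)],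
   into (i) for [t j] at [b = alpha (bar j) j y] and
   [a = alpha (bar i) j x], and these range over all of [X]. *)

Require Import Defs.
From mathcomp Require Import all_boot.
From mathcomp Require Import boolp classical_sets functions.

Local Open Scope classical_set_scope.
Local Open Scope shelf_scope.

Lemma twist_reflectionE (T : Type) (X : shelf) (alpha : T -> T -> X -> X)
    (alphaP : twist_compatible alpha) (bar : T -> T) (K : T -> X -> X) :
  reflection bar (twist_pshelf alphaP) K <->
  forall (i j : T) (x y : X),
    let u := alpha j (bar i) (K j y) ▷ x in
    let v := alpha (bar j) (bar i) y ▷ x in
    K i u = K i v /\
    alpha i j (K i u) ▷ K j y = K j (alpha i (bar j) (K i v) ▷ y).
Proof.
split=> [refl i j x y u v|E i j [x y]].
  by have [] := refl i j (x, y).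
by have [] := E i j x y; rewrite /= => e1 e2; congr pair.
Qed.

Theorem theorem2p5 (X : shelf) (I : set nat)
    (Ipos : I `<=` [set n | (0 < n)%N])
    (bar : I -> I) (barK : involutive bar)
    (alpha : I -> I -> X -> X)
    (alpha_bij : forall i j : I, bijective (alpha i j))
    (alphaP : forall (i j h : I) (a b : X),
        alpha i h a ▷ alpha j h b = alpha j h (alpha i j a ▷ b))
    (t kappa : I -> X -> X)
    (t_bij : forall i : I, bijective (t i))
    (kappa_bij : forall i : I, bijective (kappa i))
    (kappaE : forall i : I, kappa i =1 t i \o alpha (bar i) i) :
  bijective_reflection bar (twist_pshelf alphaP) kappa <->
  (forall (i : I) (a b : X),
      t i ((b ▷ a) ▷ b) = (b ▷ a) ▷ t i b) /\
  (forall (i j : I) (a b : X),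
      alpha (bar i) j (bij_inv (alpha_bij (bar i) i) a) ▷ b =
      alpha i j (t i a) ▷ b).
Proof.
have kappa_inj i : injective (kappa i) := bij_inj (kappa_bij i).
(* The two hypotheses are (ii) with [a = alpha (bar i) i z], at [j] and [bar j]; each direction
   obtains them differently. *)
have second_component i j x y :
    (forall z b, alpha i j (kappa i z) ▷ b = alpha (bar i) j z ▷ b) ->
    (forall z b,
        alpha i (bar j) (kappa i z) ▷ b = alpha (bar i) (bar j) z ▷ b) ->
    let v := alpha (bar j) (bar i) y ▷ x in
    let b := alpha (bar j) j y in
    let a := alpha (bar i) j x in
    alpha i j (kappa i v) ▷ kappa j y = (b ▷ a) ▷ t j b /\
    kappa j (alpha i (bar j) (kappa i v) ▷ y) = t j ((b ▷ a) ▷ b).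
  move=> Ej Ebj v b a.
  (* Compatibility gives [alpha (bar i) j v = b ▷ a] and carries [alpha (bar j) j] through the
     product under [t j]. *)
  by rewrite Ej Ebj !kappaE /= -alphaP /v -alphaP.
split=> [[/twist_reflectionE refl _]|[ti aii]].
  have kappa_absorb i j z b :
      alpha i j (kappa i z) ▷ b = alpha (bar i) j z ▷ b.
    (* The first index [bar j] enters as [bar (bar j) = j], so every [j] is reached. *)
    by have [/kappa_inj] := refl (bar j) i b z; rewrite barK.
  split=> [i a b|i j a b].
    (* With both indices equal to [i], the single map [alpha (bar i) i] produces both arguments, so
       [g] gives preimages of [a] and [b]. *)
    have [g _ gK] := alpha_bij (bar i) i.
    have [e1 e2] := refl i i (g a) (g b).
    have := second_component i i (g a) (g b)
      (@kappa_absorb _ _) (@kappa_absorb _ _).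
    by rewrite /= !gK => -[<- <-]; rewrite -e2 e1.
  by rewrite -kappa_absorb kappaE /= bij_invVK.
have kappa_absorb i j z b :
    alpha i j (kappa i z) ▷ b = alpha (bar i) j z ▷ b.
  by rewrite kappaE /= -aii bij_invK.
split=> //; apply/twist_reflectionE => i j x y u v.
have -> : u = v by apply: kappa_absorb.
split=> //.
have := second_component i j x y (@kappa_absorb _ _) (@kappa_absorb _ _).
by move=> [-> ->]; rewrite ti.
Qed.
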